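(* Let $U\subset\mathbb{R}^n$ be open and let $F=\sqrt[m]{A}$ be an $m$-th root Finsler metric on $U$, where $A(x,y)=a_{i_1\dots i_m}(x)y^{i_1}\cdots y^{i_m}$. Then $F$ is an Antonelli metric (with respect to the standard coordinates $(x^i,y^i)$ of $TU$) if and only if there exist functions $\Gamma^i_{lk}=\Gamma^i_{lk}(y)$, dependent only on direction, such that for all $l=1,\dots,n$ $$A_{x^l}=\Big[\Gamma^i_{lk}y^k+\frac12\Gamma^i_{jk,l}\,y^jy^k\Big]A_i,$$ where $\Gamma^i_{jk,l}=\frac{\partial\Gamma^i_{jk}}{\partial y^l}$.
   Context: Summation over repeated indices is understood; $(x^i,y^i)$ are the standard coordinates on $TU=U\times\mathbb{R}^n$, and identities involving $y$ hold for all $x\in U$, $y\neq 0$. A Finsler metric on $U$ is a function $F:TU\to[0,\infty)$ that is $C^\infty$ for $y\ne0$, satisfies $F(x,\lambda y)=\lambda F(x,y)$ for $\lambda>0$, and for which $g_{ij}=\frac12\frac{\partial^2F^2}{\partial y^i\partial y^j}$ is positive definite for $y\neq0$; $(g^{ij})$ is its inverse. An $m$-th root Finsler metric ($m\ge 2$ an integer) is a Finsler metric of the form $F=\sqrt[m]{A}$ with $A=a_{i_1\dots i_m}(x)y^{i_1}\cdots y^{i_m}$, where the functions $a_{i_1\dots i_m}$ are smooth on $U$ and symmetric in all indices. Notation: $A_{x^l}=\frac{\partial A}{\partial x^l}$, $A_i=\frac{\partial A}{\partial y^i}$, $A_{ij}=\frac{\partial^2A}{\partial y^i\partial y^j}$.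 Standing assumption: the matrix $(A_{ij})$ is positive definite for $y\neq 0$. The spray coefficients of $F$ are $G^i=\frac14g^{il}\Big\{\frac{\partial^2F^2}{\partial x^k\partial y^l}y^k-\frac{\partial F^2}{\partial x^l}\Big\}$. ''Functions dependent only on direction'' means smooth functions $\Gamma^i_{jk}(y)$ on $\mathbb{R}^n\setminus\{0\}$, independent of $x$ and positively homogeneous of degree $0$ in $y$; as usual for such coefficients they are symmetric, $\Gamma^i_{jk}=\Gamma^i_{kj}$. $F$ is an Antonelli metric (with respect to the given coordinates) if its spray coefficients depend on direction alone, i.e. $G^i=\frac12\Gamma^i_{jk}(y)y^jy^k$ for such functions $\Gamma^i_{jk}$. *)

(* Defs.v *)
From HB Require Import structures.
From mathcomp Require Import all_boot all_order all_algebra.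
From mathcomp Require Import perm.
From mathcomp Require Import all_classical all_reals all_analysis.

Set Implicit Arguments.
Unset Strict Implicit.
Unset Printing Implicit Defensive.

Import Order.TTheory GRing.Theory Num.Theory.
Import numFieldNormedType.Exports.

Local Open Scope classical_set_scope.
Local Open Scope ring_scope.

Section Smooth.
Variables (R : realType) (V : normedModType R).

(* Meant for [D] open in a finite-dimensional [V]: all iterated derivatives of
   order at most [k] along constant vectors exist and are continuous on [D]. *)
Fixpoint Ck_on (k : nat) (D : set V) (f : V -> R) : Prop :=
  (forall p, D p -> {for p, continuous f}) /\
  (if k is k'.+1 then
     forall v : V, (forall p, D p -> derivable f p v) /\ Ck_on k' D ('D_v f)
   else True).

Definition smooth_on (D : set V) (f : V -> R) : Prop :=
  forall k, Ck_on k D f.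

End Smooth.

Section Finsler.
Variables (R : realType) (n : nat).
Implicit Types (U : set 'rV[R]_n) (F f : 'rV[R]_n -> 'rV[R]_n -> R).
Implicit Types (x y : 'rV[R]_n) (i j k l : 'I_n).

(* Functions on [TU] are curried, [f x y], and total; only their values at
   base points of the open set [U] matter. *)

(* [x^l]- and [y^l]-partial derivatives; [delta_mx 0 l] is the standard basis
   vector [e_l]. *)
Definition partial_x l f x y : R := 'D_(delta_mx 0 l) (fun x' => f x' y) x.
Definition partial_y l f x y : R := 'D_(delta_mx 0 l) (f x) y.

Definition hessian_y f x y : 'M[R]_n :=
  \matrix_(i, j) partial_y i (partial_y j f) x y.

(* Only applied to Hessians, so symmetry is not required here. *)
Definition posdefmx (M : 'M[R]_n) : Prop :=
  forall v : 'rV[R]_n, v != 0 -> 0 < (v *m M *m v^T) 0 0.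

Definition sqr_fun F : 'rV[R]_n -> 'rV[R]_n -> R := fun x y => F x y ^+ 2.

Definition fundamental_tensor F x y : 'M[R]_n :=
  2^-1 *: hessian_y (sqr_fun F) x y.

Record finsler_metric U F : Prop := FinslerMetric {
  finsler_ge0 : forall x y, U x -> 0 <= F x y;
  finsler_smooth :
    smooth_on [set p : 'rV[R]_n * 'rV[R]_n | U p.1 /\ p.2 != 0]
      (fun p => F p.1 p.2);
  finsler_homogeneous : forall x y (lambda : R), U x -> 0 < lambda ->
    F x (lambda *: y) = lambda * F x y;
  finsler_posdef : forall x y, U x -> y != 0 ->
    posdefmx (fundamental_tensor F x y) }.

Definition spray_coef F i x y : R :=
  4^-1 * \sum_l invmx (fundamental_tensor F x y) i l *
    (\sum_k partial_x k (partial_y l (sqr_fun F)) x y * y 0 k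
     - partial_x l (sqr_fun F) x y).

(* [Gam i j k] stands for [Gamma^i_{jk}]. *)
Record direction_dependent (Gam : 'I_n -> 'I_n -> 'I_n -> 'rV[R]_n -> R)
    : Prop := DirectionDependent {
  direction_smooth : forall i j k, smooth_on [set y | y != 0] (Gam i j k);
  direction_homogeneous : forall i j k y (lambda : R), y != 0 -> 0 < lambda ->
    Gam i j k (lambda *: y) = Gam i j k y;
  direction_symmetric : forall i j k y, y != 0 -> Gam i j k y = Gam i k j y }.

Definition antonelli_metric U F : Prop :=
  exists2 Gam, direction_dependent Gam &
    forall i x y, U x -> y != 0 ->
      spray_coef F i x y =
        2^-1 * \sum_j \sum_k Gam i j k y * y 0 j * y 0 k.

(* [a I] stands for [a_{i_1 ... i_m}] with [I = (i_1, ..., i_m)]. *)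
Definition mform m (a : {ffun 'I_m -> 'I_n} -> 'rV[R]_n -> R) x y : R :=
  \sum_(I : {ffun 'I_m -> 'I_n}) a I x * \prod_(r < m) y 0 (I r).

Record mth_root_metric U m (a : {ffun 'I_m -> 'I_n} -> 'rV[R]_n -> R) F
    : Prop := MthRootMetric {
  mth_root_coef_smooth : forall I, smooth_on U (a I);
  mth_root_coef_symmetric : forall (s : 'S_m) (I : {ffun 'I_m -> 'I_n}) x,
    U x -> a [ffun r => I (s r)] x = a I x;
  (* [powR] is the usual real power only on nonnegative bases. *)
  mth_root_form_ge0 : forall x y, U x -> 0 <= mform a x y;
  mth_root_formE : forall x y, U x -> F x y = mform a x y `^ (m%:R^-1);
  mth_root_finsler : finsler_metric U F }.

End Finsler.

(* Main.v *)
Require Import Defs.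
From HB Require Import structures.
From mathcomp Require Import all_boot all_order all_algebra.
From mathcomp Require Import all_classical all_reals all_analysis.
From mathcomp Require Import ring lra.

Set Implicit Arguments.
Unset Strict Implicit.
Unset Printing Implicit Defensive.

Import Order.TTheory GRing.Theory Num.Theory.
Import numFieldNormedType.Exports.

Local Open Scope classical_set_scope.
Local Open Scope ring_scope.

(** Write [L = F^2 = A^(2/m)], and for a direction-dependent [Gam] put
    [G^i = 1/2 Gam^i_jk y^j y^k] and [N^i_l = d G^i / d y^l].  By the symmetry
    of [Gam], [N^i_l] is exactly the bracket of the theorem, so the theorem
    says: [G^i] are the spray coefficients of [F] if and only if
    [A_{x^l} = N^i_l A_i], the latter meaning that [A] is constant along
    horizontal curves.  The equivalence holds for each [Gam] separately, at
    each base point [x].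

    Reduction from [F] to [A] ([spray_mth_root]).  Since [g_ij] is invertible,
    [G^i] are the spray coefficients if and only if
    [2 L_ji G^i = L_{x^k y^j} y^k - L_{x^j}].  The chain rule expresses the
    derivatives of [L] through those of [A], and contracting with [y^j],
    through Euler's identities, shows that the system is equivalent to
      (1) [2 A_i G^i = A_{x^k} y^k]   and
      (2) [2 A_ji G^i = A_{x^k y^j} y^k - A_{x^j}]
    ([spray_eq_reduce]).  The fractional exponent disappears because
    [(2/m) m = 2].

    Equivalence with the horizontal equation ([spray_iff_horizontal]).
    Differentiating (1) along [y^j] gives
      (3) [2 A_ji G^i + 2 A_i N^i_j = A_{x^k y^j} y^k + A_{x^j}],
    and (3) minus (2) is [2 A_i N^i_j = 2 A_{x^j}].  Conversely, contracting
    [A_{x^l} = N^i_l A_i] with [y^l] gives (1), because [N^i_l y^l = 2 G^i];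
    hence (3) holds, and (2) follows by subtraction.

    On the analytic side, [A] and its [x]-derivatives are polynomials in [y],
    for which differentiability and Euler's identities are obtained together
    ([homogeneous_C2]).  The identity [N^i_l y^l = 2 G^i] needs
    [Gam^i_jk,l y^l = 0]; smoothness of [Gam] is expressed by directional
    derivatives only, whose additivity in the direction comes from the mean
    value theorem ([is_derive_add_dir]). *)

(** * Directional derivatives of scalar functions *)

(** The product, scaling and sum rules below are stated for lambda-abstractions:
    this is the form in which the functions of the proof occur. *)
Lemma is_derive_mulr (R : realType) (V : normedModType R) (f g : V -> R)
    (x v : V) (df dg : R) :
  is_derive x v f df -> is_derive x v g dg ->
  is_derive x v (fun y => f y * g y) (df * g x + f x * dg).
Proof.
move=> hf hg; apply: (is_derive_eq (is_deriveM hf hg)).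
by rewrite /GRing.scale /= addrC [g x * df]mulrC.
Qed.

Lemma is_derive_mulrl (R : realType) (V : normedModType R) (c : R)
    (f : V -> R) (x v : V) (df : R) :
  is_derive x v f df -> is_derive x v (fun y => c * f y) (c * df).
Proof. by move=> hf; exact: (is_deriveZ c hf). Qed.

Lemma is_derive_bigsum (R : realType) (V : normedModType R) (I : finType)
    (f : I -> V -> R) (x v : V) (df : I -> R) :
  (forall i, is_derive x v (f i) (df i)) ->
  is_derive x v (fun y => \sum_i f i y) (\sum_i df i).
Proof.
move=> hf; have -> : (fun y => \sum_i f i y) = \sum_i f i.
  by apply/funext => y; rewrite fct_sumE.
elim/big_rec2 : _ => [|i d1 f1 _ IH]; first exact: is_derive_cst.
exact: is_deriveD.
Qed.

Lemma differentiable_bigsum (R : realType) (V : normedModType R) (I : finType)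
    (f : I -> V -> R) (x : V) :
  (forall i, differentiable (f i) x) ->
  differentiable (fun y => \sum_i f i y) x.
Proof.
move=> hf; have -> : (fun y => \sum_i f i y) = \sum_i f i.
  by apply/funext => y; rewrite fct_sumE.
elim/big_rec : _ => [|i f1 _ IH]; first exact: differentiable_cst.
exact: differentiableD.
Qed.

Lemma is_derive_line (R : realType) (V : normedModType R) (f : V -> R)
    (a v : V) (t l : R) :
  is_derive (t *: v + a) v f l ->
  is_derive t 1 (fun s : R => f (s *: v + a)) l.
Proof.
have E : (fun h : R => h^-1 *: ((f \o shift (t *: v + a)) (h *: v)
            - f (t *: v + a))) =
    (fun h : R => h^-1 *: (((fun s : R => f (s *: v + a)) \o shift t) (h *: 1)
            - f (t *: v + a))).
  apply/funext => h; congr (_ *: (f _ - _)) => /=.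
  by rewrite [h *: 1]mulr1 scalerDl addrA.
case; rewrite /derivable /derive E => df dfl; exact: DeriveDef.
Qed.

(** Reduces directional derivatives to derivatives on the real line, so that
    the chain rule and the mean value theorem become available. *)
Lemma is_derive_line0 (R : realType) (V : normedModType R) (f : V -> R)
    (a v : V) (l : R) :
  is_derive (0 : R) 1 (fun s : R => f (s *: v + a)) l <-> is_derive a v f l.
Proof.
split; last first.
  by move=> h; apply: is_derive_line; rewrite scale0r add0r.
have E : (fun h : R => h^-1 *: ((f \o shift a) (h *: v) - f a)) =
    (fun h : R => h^-1 *: (((fun s : R => f (s *: v + a)) \o shift 0) (h *: 1)
            - (fun s : R => f (s *: v + a)) 0)).
  apply/funext => h /=.
  by rewrite [h *: 1]mulr1 addr0 scale0r add0r.
case; rewrite /derivable /derive -E => df dfl; exact: DeriveDef.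
Qed.

(** Chain rule that needs [f] to be derivable in the one direction [v] only. *)
Lemma is_derive_comp1 (R : realType) (V : normedModType R) (phi : R -> R)
    (f : V -> R) (x v : V) (dphi df : R) :
  is_derive (f x) 1 phi dphi -> is_derive x v f df ->
  is_derive x v (fun y => phi (f y)) (dphi * df).
Proof.
move=> hphi /is_derive_line0 hf; apply/is_derive_line0.
by apply: is_derive1_comp hf; rewrite scale0r add0r.
Qed.

Lemma is_derive_scale_dir (R : realType) (V : normedModType R) (f : V -> R)
    (x v : V) (c df : R) :
  is_derive x v f df -> is_derive x (c *: v) f (c * df).
Proof.
move=> /is_derive_line0 hf; apply/is_derive_line0; rewrite mulrC.
have -> : (fun s : R => f (s *: (c *: v) + x)) =
    (fun s : R => f (s *: v + x)) \o (fun s => c * s).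
  by apply/funext => s /=; rewrite scalerA mulrC.
apply: is_derive1_comp; first by rewrite mulr0.
by apply: is_derive_eq (is_derive_mulrl c (is_derive_id _ _)) _; rewrite mulr1.
Qed.

(** Split the increment along [h (u + v)] at [h u + x].  The first part gives
    [du]; by the mean value theorem the second one is [h] times a value of
    ['D_v f] at a point that tends to [x] with [h]. *)
Lemma is_derive_add_dir (R : realType) (V : normedModType R) (D : set V)
    (f : V -> R) (x u v : V) (du : R) :
  open D -> D x -> is_derive x u f du ->
  (forall y, D y -> derivable f y v) -> {for x, continuous ('D_v f)} ->
  is_derive x (u + v) f (du + 'D_v f x).
Proof.
move=> oD Dx [dfu Edu] dfv cfv.
suff hcvg : (fun h : R => h^-1 *: ((f \o shift x) (h *: (u + v)) - f x))
    @ 0^' --> du + 'D_v f x.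
  by apply: DeriveDef; [apply/cvg_ex; eexists; exact: hcvg|exact: cvg_lim hcvg].
pose q (h : R) := h^-1 *: ((f \o shift x) (h *: u) - f x).
pose r (h : R) := h^-1 *: (f (h *: (u + v) + x) - f (h *: u + x)).
have -> : (fun h : R => h^-1 *: ((f \o shift x) (h *: (u + v)) - f x)) = q + r.
  by apply/funext => h; rewrite /q /r !fctE /= -scalerDr; congr (_ *: _); ring.
apply: cvgD; first by rewrite -Edu; exact: dfu.
apply/cvgrPdist_le => e e0.
have : \forall y \near x, D y /\ `|'D_v f x - 'D_v f y| <= e.
  apply: filterI; first exact: open_nbhs_nbhs.
  by move/cvgrPdist_le : cfv; exact.
move=> /nbhs_ballP[d /= d0 hd].
(* a radius inside which the whole segment of the mean value theorem stays *)
pose C := `|u| + `|v| + 1.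
have C0 : 0 < C by rewrite ltr_wpDl// addr_ge0.
have : \forall h \near (0 : R)^', h != 0 /\ `|h| < d / C.
  have h1 : \forall h \near (0 : R)^', `|h| < d / C.
    by apply: dnbhs0_lt; exact: divr_gt0.
  apply: filterI; [exact: withinT|exact: h1].
apply: filterS => h -[h0 hC].
have seg (t : R) : 0 <= t <= 1 -> ball x d (t *: (h *: v) + (h *: u + x)).
  move=> /andP[t0 t1]; rewrite -ball_normE /ball_ /= distrC addrA addrK.
  have : `|t *: (h *: v) + h *: u| <= `|h| * (`|u| + `|v|).
    apply: (le_trans (ler_normD _ _)); rewrite !normrZ mulrDr addrC lerD2l.
    by rewrite ler_piMl ?mulr_ge0// ger0_norm.
  move=> /le_lt_trans; apply.
  move: hC; rewrite ltr_pdivlMr// => /(le_lt_trans _); apply.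
  by rewrite ler_wpM2l// /C lerDl.
(* Parametrizing the segment by [0, 1] treats both signs of [h] at once. *)
have hder (t : R) : 0 <= t <= 1 -> is_derive t 1
    (fun s : R => f (s *: (h *: v) + (h *: u + x)))
    (h * 'D_v f (t *: (h *: v) + (h *: u + x))).
  move=> t01; apply: is_derive_line; apply: is_derive_scale_dir.
  by apply: derivableP; apply: dfv; case: (hd _ (seg _ t01)).
have [||c c01] := @MVT_segment R (fun s : R => f (s *: (h *: v) + (h *: u + x)))
  (fun t => h * 'D_v f (t *: (h *: v) + (h *: u + x))) 0 1 ler01.
- by move=> t; rewrite in_itv /= => /andP[t0 t1]; apply: hder; rewrite !ltW.
- apply: derivable_within_continuous => t; rewrite in_itv /= => t01.
  by case: (hder _ t01).
move: c01; rewrite in_itv /= => c01.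
rewrite scale1r scale0r add0r subr0 mulr1 => E.
rewrite /r [h *: (u + v)]scalerDr [h *: u + h *: v]addrC -addrA E.
by rewrite [_ *: _]mulKf//; case: (hd _ (seg _ c01)).
Qed.

(** Continuous directional derivatives are enough here: differentiability of
    [f] at [x] is replaced by [is_derive_add_dir]. *)
Lemma derive_rowE (R : realType) (n : nat) (D : set 'rV[R]_n)
    (f : 'rV[R]_n -> R) (x w : 'rV[R]_n) :
  open D -> D x -> (forall v y, D y -> derivable f y v) ->
  (forall v, {for x, continuous ('D_v f)}) ->
  'D_w f x = \sum_l w 0 l * 'D_(delta_mx 0 l) f x.
Proof.
move=> oD Dx df cf.
suff h : is_derive x (\sum_l w 0 l *: delta_mx 0 l) f
    (\sum_l w 0 l * 'D_(delta_mx 0 l) f x).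
  by rewrite {1}(row_sum_delta w); exact: derive_val.
elim/big_rec2 : _ => [|l d u _ IH]; first exact: is_derive0.
have hl : is_derive x (w 0 l *: delta_mx 0 l) f
    (w 0 l * 'D_(delta_mx 0 l) f x).
  by apply: is_derive_scale_dir; apply: derivableP; exact: df.
have := is_derive_add_dir oD Dx IH
  (fun y => df (w 0 l *: delta_mx 0 l) y) (cf _).
by rewrite (@derive_val _ _ _ _ _ _ _ hl) [u + _]addrC [d + _]addrC.
Qed.

Lemma C1_of_smooth (R : realType) (V : normedModType R) (D : set V)
    (f : V -> R) : smooth_on D f ->
  (forall v x, D x -> derivable f x v) /\
  (forall v x, D x -> {for x, continuous ('D_v f)}).
Proof.
move=> /(_ 1%N)[_ h]; split=> v x Dx; first by case: (h v) => + _; exact.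
by case: (h v) => _ [+ _]; exact.
Qed.

Lemma derive_homog0 (R : realType) (V : normedModType R) (f : V -> R) (x : V) :
  (forall t : R, 0 < t -> f (t *: x) = f x) -> 'D_x f x = 0.
Proof.
move=> hf; apply/lim_near_cst => //=.
have : \forall h \near (0 : R)^', `|h| < 1 by exact: dnbhs0_lt.
apply: filterS => h; rewrite ltr_norml => /andP[h1 _].
have -> : h *: x + x = (h + 1) *: x by rewrite scalerDl scale1r.
by rewrite hf ?subrr ?scaler0// -ltrBlDr sub0r.
Qed.

(** * Homogeneous polynomial functions *)

(** Functions with as much regularity as two derivatives in [y] require,
    together with Euler's identities of degree [d] for the function and of
    degree [d - 1] for its derivatives.  All four properties are stable under
    products, so that monomials satisfy them by induction, without any formula
    for their derivatives. *)
Record homogeneous_C2 (R : realType) (n : nat) (d : R)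
    (p : 'rV[R]_n -> R) : Prop := HomogeneousC2 {
  homC2_diff : forall y, differentiable p y;
  homC2_derive_diff : forall v y, differentiable ('D_v p) y;
  homC2_euler : forall y, 'D_y p y = d * p y;
  homC2_derive_euler : forall v y, 'D_y ('D_v p) y = (d - 1) * 'D_v p y }.

Lemma homC2_is_derive (R : realType) (n : nat) (d : R) (p : 'rV[R]_n -> R) :
  homogeneous_C2 d p -> forall v y, is_derive y v p ('D_v p y).
Proof. by move=> hp v y; apply/derivableP/diff_derivable; case: hp. Qed.

Lemma homC2_is_derive2 (R : realType) (n : nat) (d : R) (p : 'rV[R]_n -> R) :
  homogeneous_C2 d p -> forall u v y, is_derive y u ('D_v p) ('D_u ('D_v p) y).
Proof. by move=> hp u v y; apply/derivableP/diff_derivable; case: hp. Qed.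

Lemma differentiable_rowE (R : realType) (n : nat) (f : 'rV[R]_n -> R)
    (x w : 'rV[R]_n) :
  differentiable f x -> \sum_l w 0 l * 'D_(delta_mx 0 l) f x = 'D_w f x.
Proof.
move=> df; rewrite [in RHS](row_sum_delta w) deriveE// linear_sum.
by apply: eq_bigr => l _; rewrite linearZ/= deriveE.
Qed.

Lemma homC2_mul (R : realType) (n : nat) (d e : R) (p q : 'rV[R]_n -> R) :
  homogeneous_C2 d p -> homogeneous_C2 e q ->
  homogeneous_C2 (d + e) (fun y => p y * q y).
Proof.
move=> hp hq.
have pqE v y : 'D_v (fun y => p y * q y) y = 'D_v p y * q y + p y * 'D_v q y.
  exact: (@derive_val _ _ _ _ _ _ _
    (is_derive_mulr (homC2_is_derive hp v y) (homC2_is_derive hq v y))).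
have pq v : 'D_v (fun y => p y * q y) =
  (fun y => 'D_v p y * q y + p y * 'D_v q y) by apply/funext => y; exact: pqE.
split=> [y|v y|y|v y].
- by apply: differentiableM; [case: hp|case: hq].
- by rewrite pq; apply: differentiableD; apply: differentiableM;
    case: hp; case: hq.
- by rewrite pqE (homC2_euler hp) (homC2_euler hq) /=; ring.
- rewrite pq; pose D1 := is_derive_mulr (homC2_is_derive2 hp y v y)
    (homC2_is_derive hq y y).
  pose D2 := is_derive_mulr (homC2_is_derive hp y y)
    (homC2_is_derive2 hq y v y).
  rewrite (@derive_val _ _ _ _ _ _ _ (is_deriveD D1 D2)).
  rewrite (homC2_euler hp) (homC2_euler hq).
  by rewrite (homC2_derive_euler hp) (homC2_derive_euler hq) pqE; ring.
Qed.

Lemma homC2_cst (R : realType) (n : nat) (c : R) :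
  homogeneous_C2 0 (fun _ : 'rV[R]_n => c).
Proof.
have D0 v : 'D_v (fun _ : 'rV[R]_n => c) = cst 0.
  by apply/funext => y; exact: derive_cst.
split=> [y|v y|y|v y]; rewrite ?D0 ?mul0r ?mulr0//.
  exact: derive_cst.
rewrite [LHS]derive_cst; have /(congr1 (@^~ y)) /= -> := D0 v.
by rewrite mulr0.
Qed.

Lemma derive_coord (R : realType) (n : nat) (i : 'I_n) (v y : 'rV[R]_n) :
  'D_v (fun y : 'rV[R]_n => y 0 i) y = v 0 i.
Proof.
apply/lim_near_cst => //=; near=> h.
rewrite !mxE addrK [_ *: _]mulKf//.
by near: h; exact: withinT.
Unshelve. all: by end_near. Qed.

Lemma homC2_coord (R : realType) (n : nat) (i : 'I_n) :
  homogeneous_C2 1 (fun y : 'rV[R]_n => y 0 i).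
Proof.
have D v : 'D_v (fun y : 'rV[R]_n => y 0 i) = cst (v 0 i).
  by apply/funext => y; exact: derive_coord.
split=> [y|v y|y|v y]; rewrite ?D ?derive_coord ?mul1r//.
  exact: differentiable_coord.
by rewrite [LHS]derive_cst subrr mul0r.
Qed.

Lemma homC2_monomial (R : realType) (n m : nat) (I : 'I_m -> 'I_n) :
  homogeneous_C2 m%:R (fun y : 'rV[R]_n => \prod_(r < m) y 0 (I r)).
Proof.
suff h s : homogeneous_C2 (size s)%:R
    (fun y : 'rV[R]_n => \prod_(r <- s) y 0 (I r)).
  by have := h (index_enum 'I_m); rewrite /index_enum -enumT size_enum_ord.
elim: s => [|r s IH].
  under eq_fun do rewrite big_nil.
  exact: homC2_cst.
under eq_fun do rewrite big_cons.
by rewrite /= -add1n natrD; apply: homC2_mul => //; exact: homC2_coord.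
Qed.

Lemma derive_lincombE (R : realType) (n : nat) (T : finType) (d : R)
    (q : T -> 'rV[R]_n -> R) (c : T -> R) (v : 'rV[R]_n) :
  (forall t, homogeneous_C2 d (q t)) ->
  forall y, 'D_v (fun y => \sum_t c t * q t y) y = \sum_t c t * 'D_v (q t) y.
Proof.
move=> hq y.
apply: (@derive_val _ _ _ _ _ _ _ (is_derive_bigsum _)) => t.
by apply: is_derive_mulrl; exact: (homC2_is_derive (hq t)).
Qed.

Lemma homC2_lincomb (R : realType) (n : nat) (T : finType) (d : R)
    (q : T -> 'rV[R]_n -> R) (c : T -> R) :
  (forall t, homogeneous_C2 d (q t)) ->
  homogeneous_C2 d (fun y => \sum_t c t * q t y).
Proof.
move=> hq.
have lin v : 'D_v (fun y => \sum_t c t * q t y) =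
    (fun y => \sum_t c t * 'D_v (q t) y).
  by apply/funext => y; exact: derive_lincombE.
split=> [y|v y|y|v y]; rewrite ?lin ?(derive_lincombE _ _ hq).
- apply: differentiable_bigsum => t; apply: differentiableZ.
  exact: homC2_diff (hq t) y.
- apply: differentiable_bigsum => t; apply: differentiableZ.
  exact: homC2_derive_diff (hq t) v y.
- rewrite mulr_sumr; apply: eq_bigr => t _.
  by rewrite (homC2_euler (hq t)) mulrCA.
- have D : is_derive y y (fun y => \sum_t c t * 'D_v (q t) y)
      (\sum_t c t * 'D_y ('D_v (q t)) y).
    apply: is_derive_bigsum => t; apply: is_derive_mulrl.
    exact: (homC2_is_derive2 (hq t)).
  rewrite (@derive_val _ _ _ _ _ _ _ D) mulr_sumr; apply: eq_bigr => t _.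
  by rewrite (homC2_derive_euler (hq t)) mulrCA.
Qed.

(** Euler's identities in coordinates; in the next one the contraction is with
    the outer derivative, the form in which the Hessian occurs. *)
Lemma homC2_euler_sum (R : realType) (n : nat) (d : R) (p : 'rV[R]_n -> R)
    (y : 'rV[R]_n) :
  homogeneous_C2 d p -> \sum_l y 0 l * 'D_(delta_mx 0 l) p y = d * p y.
Proof.
move=> hp; rewrite (differentiable_rowE _ (homC2_diff hp y)).
exact: homC2_euler.
Qed.

Lemma homC2_derive_euler_sum (R : realType) (n : nat) (d : R)
    (p : 'rV[R]_n -> R) (v y : 'rV[R]_n) :
  homogeneous_C2 d p ->
  \sum_l y 0 l * 'D_(delta_mx 0 l) ('D_v p) y = (d - 1) * 'D_v p y.
Proof.
move=> hp; rewrite (differentiable_rowE _ (homC2_derive_diff hp v y)).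
exact: homC2_derive_euler.
Qed.

Lemma open_nonzero_row (R : realType) (n : nat) :
  open [set y : 'rV[R]_n | y != 0].
Proof.
rewrite openE => y /= y0.
exact: (cvgr_neq0 y (@cvg_id _ (nbhs y)) y0).
Qed.

(** * Linear algebra of the spray equation *)

Lemma posdefmx_unit (R : realType) (n : nat) (M : 'M[R]_n) :
  posdefmx M -> M \in unitmx.
Proof.
move=> hM; rewrite -row_free_unit -kermx_eq0; apply/eqP/row_matrixP => i.
rewrite row0; apply/eqP/negPn/negP => /hM.
by rewrite -row_mul mulmx_ker row0 mul0mx mxE ltxx.
Qed.

Lemma invmx_solve (R : realType) (n : nat) (M : 'M[R]_n) (g h : 'I_n -> R) :
  M \in unitmx ->
  (forall i, \sum_l invmx M i l * h l = g i) <->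
  (forall j, \sum_i M j i * g i = h j).
Proof.
move=> Mu; have colE (A : 'M[R]_n) (u v : 'I_n -> R) :
    (forall i, \sum_l A i l * u l = v i) <->
    A *m (\col_i u i) = \col_i v i.
  split=> [E|/matrixP E i].
    apply/matrixP => i j; rewrite !mxE -E.
    by apply: eq_bigr => l _; rewrite mxE.
  by have := E i 0; rewrite !mxE => <-; apply: eq_bigr => l _; rewrite mxE.
rewrite !colE; split=> <-; first by rewrite mulKVmx.
by rewrite mulKmx.
Qed.

(** Pointwise algebra behind the passage from [L = phi(A)] to [A].  Here [t] is
    the value of [A]; [p] and [q] are those of [phi'] and [phi''], so that
    [t q = (c - 1) p] for [phi(t) = t^c]; [A1], [H], [B] and [M] stand for
    [A_i], [A_ji], [A_{x^k}] and [A_{x^k y^j}].  Contracting the system with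
    [y^j] gives [2 (c m - 1) p A_i G^i = (c m - 1) p A_{x^k} y^k], and
    [c m - 1 = 1]; then the terms with [q] cancel in the system itself. *)
Lemma spray_eq_reduce (R : realType) (n : nat) (m c t p q : R)
    (A1 B G y : 'I_n -> R) (H M : 'I_n -> 'I_n -> R) :
  c * m = 2 -> p != 0 -> t * q = (c - 1) * p ->
  \sum_j y j * A1 j = m * t ->
  (forall i, \sum_j y j * H j i = (m - 1) * A1 i) ->
  (forall k, \sum_j y j * M j k = m * B k) ->
  (forall j, 2 * \sum_i (q * A1 j * A1 i + p * H j i) * G i =
     \sum_k (q * B k * A1 j + p * M j k) * y k - p * B j) <->
  (2 * \sum_i A1 i * G i = \sum_k B k * y k /\
   forall j, 2 * \sum_i H j i * G i = \sum_k M j k * y k - B j).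
Proof.
move=> cm p0 tq eA eH eM.
set AG := \sum_i A1 i * G i; set X := \sum_k B k * y k.
have lE j : \sum_i (q * A1 j * A1 i + p * H j i) * G i =
    q * A1 j * AG + p * \sum_i H j i * G i.
  rewrite !mulr_sumr -big_split; apply: eq_bigr => i _ /=; ring.
have rE j : \sum_k (q * B k * A1 j + p * M j k) * y k =
    q * A1 j * X + p * \sum_k M j k * y k.
  rewrite !mulr_sumr -big_split; apply: eq_bigr => i _ /=; ring.
split=> [E|[E1 E2] j]; last first.
  have : p * (2 * \sum_i H j i * G i) = p * (\sum_k M j k * y k - B j).
    by rewrite E2.
  by move=> E; rewrite lE rE -E1; lra.
(* Contraction with [y^j] through an Euler identity for the kernel [K]. *)
have exch (K : 'I_n -> 'I_n -> R) (u v : 'I_n -> R) d :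
    (forall i, \sum_j y j * K j i = d * u i) ->
    \sum_j y j * (\sum_i K j i * v i) = d * \sum_i u i * v i.
  move=> hK; under eq_bigr do rewrite mulr_sumr.
  rewrite exchange_big mulr_sumr; apply: eq_bigr => i _ /=.
  rewrite mulrA -hK mulr_suml; apply: eq_bigr => j _; ring.
have contract (a b : R) (HG MY : 'I_n -> R) :
    \sum_j y j * B j = b ->
    (forall j, 2 * (q * A1 j * a + p * HG j) =
       q * A1 j * b + p * MY j - p * B j) ->
    \sum_j y j * HG j = (m - 1) * a -> \sum_j y j * MY j = m * b ->
    2 * a = b.
  move=> eB E' eHG eMY.
  have : \sum_j y j * (2 * (q * A1 j * a + p * HG j)) =
      \sum_j y j * (q * A1 j * b + p * MY j - p * B j).
    by apply: eq_bigr => j _; rewrite E'.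
  have -> : \sum_j y j * (2 * (q * A1 j * a + p * HG j)) =
      2 * (q * a * (m * t) + p * ((m - 1) * a)).
    rewrite -eA -eHG !mulr_sumr -big_split mulr_sumr /=.
    apply: eq_bigr => j _; ring.
  have -> : \sum_j y j * (q * A1 j * b + p * MY j - p * B j) =
      q * b * (m * t) + p * (m * b) - p * b.
    rewrite -eA -eMY -[in p * b]eB !mulr_sumr -big_split -sumrB /=.
    apply: eq_bigr => j _; ring.
  move=> E1; apply: (mulfI p0).
  (* Insert the factor [c m - 1 = 1], which both sides acquire. *)
  have -> : p * b = p * b * (c * m - 1) by rewrite cm; ring.
  have -> : p * (2 * a) = 2 * p * a * (c * m - 1) by rewrite cm; ring.
  have e1 : q * a * (m * t) = m * a * ((c - 1) * p) by rewrite -tq; ring.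
  have e2 : q * b * (m * t) = m * b * ((c - 1) * p) by rewrite -tq; ring.
  by move: E1; rewrite e1 e2; lra.
have E1 : 2 * AG = X.
  apply: (contract _ _ (fun j => \sum_i H j i * G i)
    (fun j => \sum_k M j k * y k)).
  - by apply: eq_bigr => k _; rewrite mulrC.
  - by move=> j; rewrite -lE -rE E.
  - exact: exch.
  - by rewrite (exch _ _ _ _ eM).
split=> // j; apply: (mulfI p0).
by have := E j; rewrite lE rE -E1; lra.
Qed.

(** * The form [A] of an [m]-th root metric *)

Lemma homC2_mform (R : realType) (n m : nat)
    (a : {ffun 'I_m -> 'I_n} -> 'rV[R]_n -> R) (x : 'rV[R]_n) :
  homogeneous_C2 m%:R (mform a x).
Proof.
exact: (homC2_lincomb (fun I => a I x)
  (fun I : {ffun 'I_m -> 'I_n} => @homC2_monomial R n m I)).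
Qed.

Lemma is_derive_x_mform (R : realType) (n m : nat) (U : set 'rV[R]_n)
    (a : {ffun 'I_m -> 'I_n} -> 'rV[R]_n -> R) (k : 'I_n) (x y : 'rV[R]_n) :
  (forall I, smooth_on U (a I)) -> U x ->
  is_derive x (delta_mx 0 k) (fun x' => mform a x' y)
    (partial_x k (mform a) x y).
Proof.
move=> sa Ux; apply: derivableP.
apply: (@ex_derive _ _ _ _ _ _ _ (is_derive_bigsum (fun I =>
  is_derive_mulr (derivableP ((C1_of_smooth (sa I)).1 _ _ Ux))
    (is_derive_cst (\prod_(r < m) y 0 (I r)) _ _)))).
Qed.

(** The [x]-derivative of the form is again a form of degree [m] in [y], so it
    inherits the regularity and the Euler identities of [mform]. *)
Lemma partial_x_mformE (R : realType) (n m : nat) (U : set 'rV[R]_n)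
    (a : {ffun 'I_m -> 'I_n} -> 'rV[R]_n -> R) (k : 'I_n) (x : 'rV[R]_n) :
  (forall I, smooth_on U (a I)) -> U x ->
  partial_x k (mform a) x = mform (fun I => 'D_(delta_mx 0 k) (a I)) x.
Proof.
move=> sa Ux; apply/funext => y; rewrite /partial_x /mform.
have D := (is_derive_bigsum (fun I : {ffun 'I_m -> 'I_n} =>
  is_derive_mulr
    (derivableP ((C1_of_smooth (sa I)).1 (delta_mx 0 k) _ Ux))
    (is_derive_cst (\prod_(r < m) y 0 (I r)) _ _))).
rewrite (@derive_val _ _ _ _ _ _ _ D); apply: eq_bigr => I _.
by rewrite mulr0 addr0.
Qed.

Lemma homC2_partial_x_mform (R : realType) (n m : nat) (U : set 'rV[R]_n)
    (a : {ffun 'I_m -> 'I_n} -> 'rV[R]_n -> R) (k : 'I_n) (x : 'rV[R]_n) :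
  (forall I, smooth_on U (a I)) -> U x ->
  homogeneous_C2 m%:R (partial_x k (mform a) x).
Proof.
by move=> sa Ux; rewrite (partial_x_mformE k sa Ux); exact: homC2_mform.
Qed.

(** Derivatives in [x] act on the coefficients and those in [y] on the
    monomials; hence they commute. *)
Lemma is_derive_x_partial_y_mform (R : realType) (n m : nat)
    (U : set 'rV[R]_n) (a : {ffun 'I_m -> 'I_n} -> 'rV[R]_n -> R)
    (k l : 'I_n) (x y : 'rV[R]_n) :
  (forall I, smooth_on U (a I)) -> U x ->
  is_derive x (delta_mx 0 k) (fun x' => partial_y l (mform a) x' y)
    (partial_y l (partial_x k (mform a)) x y).
Proof.
move=> sa Ux; pose q (I : {ffun 'I_m -> 'I_n}) (y : 'rV[R]_n) :=
  \prod_(r < m) y 0 (I r).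
have hq I : homogeneous_C2 m%:R (q I) by exact: homC2_monomial.
have lin (c : {ffun 'I_m -> 'I_n} -> 'rV[R]_n -> R) x' :
    partial_y l (mform c) x' y = \sum_I c I x' * 'D_(delta_mx 0 l) (q I) y.
  exact: (derive_lincombE (fun I => c I x') (delta_mx 0 l) hq y).
rewrite /partial_y (partial_x_mformE k sa Ux) -/(partial_y l _ x y) lin.
under eq_fun do rewrite -/(partial_y l _ _ y) lin.
apply: is_derive_bigsum => I.
have D := is_derive_mulr
  (derivableP ((C1_of_smooth (sa I)).1 (delta_mx 0 k) _ Ux))
  (is_derive_cst ('D_(delta_mx 0 l) (q I) y) _ _).
by apply: is_derive_eq D _; rewrite mulr0 addr0.
Qed.

(** Euler's identities give [A_ij y^i y^j = m (m - 1) A]. *)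
Lemma homC2_gt0 (R : realType) (n m : nat) (A : 'rV[R]_n -> R)
    (y : 'rV[R]_n) :
  (2 <= m)%N -> homogeneous_C2 m%:R A ->
  posdefmx (\matrix_(i, j)
    'D_(delta_mx 0 i) ('D_(delta_mx 0 j) A) y) ->
  y != 0 -> 0 < A y.
Proof.
move=> m2 hA pA y0; have := pA _ y0; rewrite mxE.
have -> : \sum_j (y *m \matrix_(i, j)
      'D_(delta_mx 0 i) ('D_(delta_mx 0 j) A) y) 0 j * y^T j 0 =
    (m%:R - 1) * (m%:R * A y).
  rewrite -(homC2_euler_sum y hA) mulr_sumr; apply: eq_bigr => j _.
  rewrite !mxE mulrCA mulrC -(homC2_derive_euler_sum _ _ hA).
  by congr (_ * _); apply: eq_bigr => i _; rewrite mxE.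
rewrite mulrA pmulr_rgt0//; apply: mulr_gt0; last by rewrite ltr0n ltnW.
by rewrite subr_gt0 ltr1n.
Qed.

Lemma is_derive_powR (R : realType) (V : normedModType R) (c : R)
    (f : V -> R) (x v : V) (df : R) :
  0 < f x -> is_derive x v f df ->
  is_derive x v (fun y => f y `^ c) (c * f x `^ (c - 1) * df).
Proof. by move=> f0 hf; exact: (is_derive_comp1 (is_derive1_powR c f0) hf). Qed.

(** * The spray of an [m]-th root metric in terms of [A] *)

Lemma sqr_fun_mth_root (R : realType) (n m : nat) (U : set 'rV[R]_n)
    (a : {ffun 'I_m -> 'I_n} -> 'rV[R]_n -> R) (F : 'rV[R]_n -> 'rV[R]_n -> R)
    (x : 'rV[R]_n) :
  mth_root_metric U a F -> U x ->
  sqr_fun F x = (fun y => mform a x y `^ (2 / m%:R)).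
Proof.
move=> hF Ux; apply/funext => y; rewrite /sqr_fun (mth_root_formE hF y Ux).
by rewrite mulrC powRrM powR_mulrn// powR_ge0.
Qed.

(** Positivity of [A] away from [y = 0] makes [t -> t^(2/m)] smooth at the
    values of [A], so [L = F^2] may be differentiated by the chain rule;
    [spray_eq_reduce] then removes the exponent. *)
Lemma spray_mth_root (R : realType) (n m : nat) (U : set 'rV[R]_n)
    (a : {ffun 'I_m -> 'I_n} -> 'rV[R]_n -> R) (F : 'rV[R]_n -> 'rV[R]_n -> R)
    (x y : 'rV[R]_n) (G : 'I_n -> R) :
  open U -> (2 <= m)%N -> mth_root_metric U a F ->
  (forall x y, U x -> y != 0 -> posdefmx (hessian_y (mform a) x y)) ->
  U x -> y != 0 ->
  (forall i, spray_coef F i x y = G i) <->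
  (2 * \sum_i partial_y i (mform a) x y * G i =
     \sum_k partial_x k (mform a) x y * y 0 k /\
   forall j, 2 * \sum_i partial_y j (partial_y i (mform a)) x y * G i =
     \sum_k partial_y j (partial_x k (mform a)) x y * y 0 k
     - partial_x j (mform a) x y).
Proof.
move=> oU m2 hF pA Ux y0.
have sa := mth_root_coef_smooth hF.
have m0 : (m%:R : R) != 0 by rewrite pnatr_eq0 -lt0n ltnW.
have Apos x' y' : U x' -> y' != 0 -> 0 < mform a x' y'.
  move=> Ux' y'0.
  exact: (homC2_gt0 m2 (homC2_mform a x') (pA _ _ Ux' y'0) y'0).
have hA := homC2_mform a x.
pose c : R := 2 / m%:R.
pose phi1 (t : R) := c * t `^ (c - 1).
pose phi2 (t : R) := c * ((c - 1) * t `^ (c - 1 - 1)).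
have dphi1 (V : normedModType R) (f : V -> R) (z v : V) (df : R) :
    0 < f z -> is_derive z v f df ->
    is_derive z v (fun y => phi1 (f y)) (phi2 (f z) * df).
  move=> fz0 hf; rewrite /phi2 -mulrA.
  by apply: is_derive_mulrl; exact: is_derive_powR.
have Ly l x' y' : U x' -> y' != 0 -> partial_y l (sqr_fun F) x' y' =
    phi1 (mform a x' y') * partial_y l (mform a) x' y'.
  move=> Ux' y'0; rewrite {1}/partial_y (sqr_fun_mth_root hF Ux').
  exact: (@derive_val _ _ _ _ _ _ _ (is_derive_powR c (Apos _ _ Ux' y'0)
    (homC2_is_derive (homC2_mform a x') _ _))).
have nearU : \forall x' \near x, U x' by exact: open_nbhs_nbhs.
have near0 : \forall y' \near y, y' != 0.
  by apply: open_nbhs_nbhs; split=> //; exact: open_nonzero_row.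
have Lx k : partial_x k (sqr_fun F) x y =
    phi1 (mform a x y) * partial_x k (mform a) x y.
  have D := is_derive_powR (f := fun x' => mform a x' y) c
    (Apos _ _ Ux y0) (is_derive_x_mform k y sa Ux).
  rewrite -(@derive_val _ _ _ _ _ _ _ D); apply: near_eq_derive.
  by apply: filterS nearU => x' Ux'; rewrite (sqr_fun_mth_root hF Ux').
have Lyy j i : partial_y j (partial_y i (sqr_fun F)) x y =
    phi2 (mform a x y) * partial_y j (mform a) x y * partial_y i (mform a) x y
    + phi1 (mform a x y) * partial_y j (partial_y i (mform a)) x y.
  have D := is_derive_mulr
    (dphi1 _ _ _ _ _ (Apos _ _ Ux y0) (homC2_is_derive hA (delta_mx 0 j) y))
    (homC2_is_derive2 hA (delta_mx 0 j) (delta_mx 0 i) y).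
  rewrite -(@derive_val _ _ _ _ _ _ _ D); apply: near_eq_derive.
  by apply: filterS near0 => y' y'0; exact: Ly.
have Lyx k j : partial_x k (partial_y j (sqr_fun F)) x y =
    phi2 (mform a x y) * partial_x k (mform a) x y * partial_y j (mform a) x y
    + phi1 (mform a x y) * partial_y j (partial_x k (mform a)) x y.
  have D := is_derive_mulr
    (dphi1 _ (fun x' => mform a x' y) _ _ _ (Apos _ _ Ux y0)
      (is_derive_x_mform k y sa Ux))
    (is_derive_x_partial_y_mform k j y sa Ux).
  rewrite -(@derive_val _ _ _ _ _ _ _ D); apply: near_eq_derive.
  by apply: filterS nearU => x' Ux'; exact: Ly.
have A0 := Apos _ _ Ux y0.
have phi1_neq0 : phi1 (mform a x y) != 0.
  by rewrite mulf_neq0 ?gt_eqF ?powR_gt0// divr_gt0// ltr0n ltnW.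
have phi12 : mform a x y * phi2 (mform a x y) = (c - 1) * phi1 (mform a x y).
  rewrite /phi2 /phi1 (@powRB _ _ (c - 1) 1) ?(gt_eqF A0) ?implybT//
    powRr1 ?ltW//.
  by field; rewrite gt_eqF.
have cm : c * m%:R = 2 by rewrite /c; field.
rewrite -(spray_eq_reduce G cm phi1_neq0 phi12 (homC2_euler_sum y hA)
  (fun i => homC2_derive_euler_sum (delta_mx 0 i) y hA)
  (fun k => homC2_euler_sum y (homC2_partial_x_mform k sa Ux))).
have gu := posdefmx_unit (finsler_posdef (mth_root_finsler hF) Ux y0).
pose h l := 4^-1 * (\sum_k partial_x k (partial_y l (sqr_fun F)) x y * y 0 k
  - partial_x l (sqr_fun F) x y).
(* Inverting [g]: the spray equation becomes [g_ji G^i = h_j]. *)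
have sE i : spray_coef F i x y =
    \sum_l invmx (fundamental_tensor F x y) i l * h l.
  by rewrite /spray_coef mulr_sumr; apply: eq_bigr => l _; rewrite /h mulrCA.
transitivity (forall j, \sum_i fundamental_tensor F x y j i * G i = h j).
  by rewrite -(invmx_solve G h gu); split=> E i; rewrite -E sE.
have eqs j : \sum_i fundamental_tensor F x y j i * G i =
    2^-1 * \sum_i (phi2 (mform a x y) * partial_y j (mform a) x y *
       partial_y i (mform a) x y + phi1 (mform a x y) *
       partial_y j (partial_y i (mform a)) x y) * G i.
  by rewrite mulr_sumr; apply: eq_bigr => i _; rewrite !mxE Lyy mulrA.
have eqh j : h j = 4^-1 * (\sum_k (phi2 (mform a x y) *
     partial_x k (mform a) x y * partial_y j (mform a) x y +
     phi1 (mform a x y) * partial_y j (partial_x k (mform a)) x y) * y 0 k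
   - phi1 (mform a x y) * partial_x j (mform a) x y).
  rewrite /h Lx; congr (_ * (_ - _)); apply: eq_bigr => k _.
  by rewrite Lyx.
split=> E j; have := E j; rewrite eqs eqh.
  by move=> E'; lra.
by move=> E'; lra.
Qed.

(** * Sprays depending on direction alone *)

Definition direction_spray (R : realType) (n : nat)
    (Gam : 'I_n -> 'I_n -> 'I_n -> 'rV[R]_n -> R) (i : 'I_n)
    (y : 'rV[R]_n) : R :=
  2^-1 * \sum_j \sum_k Gam i j k y * y 0 j * y 0 k.

Definition direction_connection (R : realType) (n : nat)
    (Gam : 'I_n -> 'I_n -> 'I_n -> 'rV[R]_n -> R) (i l : 'I_n)
    (y : 'rV[R]_n) : R :=
  \sum_k Gam i l k y * y 0 k
  + 2^-1 * \sum_j \sum_k 'D_(delta_mx 0 l) (Gam i j k) y * y 0 j * y 0 k.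

Lemma is_derive_coord (R : realType) (n : nat) (j l : 'I_n) (y : 'rV[R]_n) :
  is_derive y (delta_mx 0 l) (fun y : 'rV[R]_n => y 0 j) (l == j)%:R.
Proof.
have := homC2_is_derive (homC2_coord R j) (delta_mx 0 l) y.
by rewrite derive_coord mxE eqxx eq_sym.
Qed.

Lemma sum_delta (R : realType) (n : nat) (l : 'I_n) (f : 'I_n -> R) :
  \sum_j (l == j)%:R * f j = f l.
Proof.
rewrite (bigD1 l)//= eqxx mul1r big1 ?addr0// => j jl.
by rewrite eq_sym (negPf jl) mul0r.
Qed.

(** The symmetry of [Gam] in its lower indices merges the two terms in which
    [y^j] or [y^k] is differentiated, whence the coefficient [1] of the first
    sum of [direction_connection]. *)
Lemma is_derive_direction_spray (R : realType) (n : nat)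
    (Gam : 'I_n -> 'I_n -> 'I_n -> 'rV[R]_n -> R) (i l : 'I_n)
    (y : 'rV[R]_n) :
  direction_dependent Gam -> y != 0 ->
  is_derive y (delta_mx 0 l) (direction_spray Gam i)
    (direction_connection Gam i l y).
Proof.
move=> hG y0.
have dG j k : is_derive y (delta_mx 0 l) (Gam i j k)
    ('D_(delta_mx 0 l) (Gam i j k) y).
  by apply: derivableP; apply: (C1_of_smooth (direction_smooth hG i j k)).1.
have D := is_derive_mulrl 2^-1 (is_derive_bigsum (fun j =>
  is_derive_bigsum (fun k => is_derive_mulr
    (is_derive_mulr (dG j k) (is_derive_coord j l y))
    (is_derive_coord k l y)))).
apply: is_derive_eq D _; rewrite /direction_connection.
transitivity (2^-1 * (
   \sum_j \sum_k 'D_(delta_mx 0 l) (Gam i j k) y * y 0 j * y 0 k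
   + (\sum_j (l == j)%:R * (\sum_k Gam i j k y * y 0 k)
   + \sum_j \sum_k (l == k)%:R * (Gam i j k y * y 0 j)))).
  congr (_ * _); rewrite -!big_split; apply: eq_bigr => j _ /=.
  rewrite mulr_sumr -!big_split; apply: eq_bigr => k _ /=; ring.
rewrite sum_delta.
have -> : \sum_j \sum_k (l == k)%:R * (Gam i j k y * y 0 j) =
    \sum_k Gam i l k y * y 0 k.
  by apply: eq_bigr => j _; rewrite sum_delta (direction_symmetric hG).
by field.
Qed.

(** The spray is homogeneous of degree [2]: the part of the connection that
    differentiates [Gam] is killed by [y^l], as [Gam] has degree [0]. *)
Lemma direction_connection_euler (R : realType) (n : nat)
    (Gam : 'I_n -> 'I_n -> 'I_n -> 'rV[R]_n -> R) (i : 'I_n) (y : 'rV[R]_n) :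
  direction_dependent Gam -> y != 0 ->
  \sum_l y 0 l * direction_connection Gam i l y = 2 * direction_spray Gam i y.
Proof.
move=> hG y0.
have D0 j k : \sum_l y 0 l * 'D_(delta_mx 0 l) (Gam i j k) y = 0.
  have [dG cG] := C1_of_smooth (direction_smooth hG i j k).
  rewrite -(derive_rowE _ (@open_nonzero_row R n) y0) => [|v z|v].
  - by apply: derive_homog0 => t; exact: (direction_homogeneous hG).
  - exact: dG.
  - exact: cG.
have H : \sum_l y 0 l *
    (\sum_j \sum_k 'D_(delta_mx 0 l) (Gam i j k) y * y 0 j * y 0 k) = 0.
  under eq_bigr do rewrite mulr_sumr.
  rewrite exchange_big big1// => j _ /=.
  under eq_bigr do rewrite mulr_sumr.
  rewrite exchange_big big1// => k _ /=.
  under eq_bigr do rewrite !mulrA.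
  by rewrite -!mulr_suml D0 !mul0r.
rewrite /direction_connection /direction_spray mulrA divff// mul1r.
under eq_bigr do rewrite mulrDr mulrCA.
rewrite big_split /= -[X in _ + X]mulr_sumr H mulr0 addr0.
apply: eq_bigr => l _ /=.
by rewrite mulr_sumr; apply: eq_bigr => k _; ring.
Qed.

(** On the left are the equations (1) and (2) of the introduction.  Given (1)
    on an open set, its [y^j]-derivative makes (2) and the horizontal equation
    equivalent; contraction with [y^l] recovers (1) from the latter. *)
Lemma spray_iff_horizontal (R : realType) (n : nat) (d : R)
    (A : 'rV[R]_n -> R) (B G : 'I_n -> 'rV[R]_n -> R)
    (N : 'I_n -> 'I_n -> 'rV[R]_n -> R) :
  homogeneous_C2 d A -> (forall k, homogeneous_C2 d (B k)) ->
  (forall i l (y : 'rV[R]_n), y != 0 ->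
     is_derive y (delta_mx 0 l) (G i) (N i l y)) ->
  (forall i (y : 'rV[R]_n), y != 0 -> \sum_l y 0 l * N i l y = 2 * G i y) ->
  (forall y : 'rV[R]_n, y != 0 ->
     2 * \sum_i 'D_(delta_mx 0 i) A y * G i y = \sum_k B k y * y 0 k /\
     forall j, 2 * \sum_i 'D_(delta_mx 0 j) ('D_(delta_mx 0 i) A) y * G i y =
       \sum_k 'D_(delta_mx 0 j) (B k) y * y 0 k - B j y) <->
  (forall l (y : 'rV[R]_n), y != 0 ->
     B l y = \sum_i N i l y * 'D_(delta_mx 0 i) A y).
Proof.
move=> hA hB dG NG.
have diffE : (forall y : 'rV[R]_n, y != 0 ->
      2 * \sum_i 'D_(delta_mx 0 i) A y * G i y = \sum_k B k y * y 0 k) ->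
    forall j (y : 'rV[R]_n), y != 0 ->
    2 * (\sum_i 'D_(delta_mx 0 j) ('D_(delta_mx 0 i) A) y * G i y
      + \sum_i N i j y * 'D_(delta_mx 0 i) A y) =
    \sum_k 'D_(delta_mx 0 j) (B k) y * y 0 k + B j y.
  move=> E j y y0.
  have D1 := is_derive_mulrl 2 (is_derive_bigsum (fun i => is_derive_mulr
    (homC2_is_derive2 hA (delta_mx 0 j) (delta_mx 0 i) y) (dG i j y y0))).
  have D2 := is_derive_bigsum (fun k => is_derive_mulr
    (homC2_is_derive (hB k) (delta_mx 0 j) y) (is_derive_coord k j y)).
  transitivity (2 * \sum_i ('D_(delta_mx 0 j) ('D_(delta_mx 0 i) A) y * G i y
      + 'D_(delta_mx 0 i) A y * N i j y)).
    rewrite -big_split; congr (_ * _); apply: eq_bigr => i _.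
    by rewrite [N i j y * _]mulrC.
  transitivity (\sum_k ('D_(delta_mx 0 j) (B k) y * y 0 k
      + B k y * (j == k)%:R)).
    rewrite -(@derive_val _ _ _ _ _ _ _ D1) -(@derive_val _ _ _ _ _ _ _ D2).
    apply: near_eq_derive.
    have : \forall y' \near y, y' != 0.
      by apply: open_nbhs_nbhs; split=> //; exact: open_nonzero_row.
    by apply: filterS => y' y'0; exact: E.
  rewrite big_split /=; congr (_ + _).
  by under eq_bigr do rewrite mulrC; exact: sum_delta.
split=> [E l y y0|E].
  have := diffE (fun z z0 => (E z z0).1) l y y0; have := (E y y0).2 l.
  by lra.
have E1 (y : 'rV[R]_n) : y != 0 ->
    2 * \sum_i 'D_(delta_mx 0 i) A y * G i y = \sum_k B k y * y 0 k.
  move=> y0; under [RHS]eq_bigr do rewrite (E _ _ y0) mulr_suml.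
  rewrite exchange_big mulr_sumr; apply: eq_bigr => i _ /=.
  rewrite mulrCA -(NG i y y0) mulr_sumr; apply: eq_bigr => l _; ring.
move=> y y0; split=> [|j]; first exact: E1.
by have := diffE E1 j y y0; have := E j y y0; lra.
Qed.

Theorem theorem1p2 (R : realType) (n m : nat) (U : set 'rV[R]_n)
    (a : {ffun 'I_m -> 'I_n} -> 'rV[R]_n -> R)
    (F : 'rV[R]_n -> 'rV[R]_n -> R) :
  open U -> (2 <= m)%N -> mth_root_metric U a F ->
  (forall x y, U x -> y != 0 -> posdefmx (hessian_y (mform a) x y)) ->
  antonelli_metric U F <->
  exists2 Gam : 'I_n -> 'I_n -> 'I_n -> 'rV[R]_n -> R,
    direction_dependent Gam &
    forall (l : 'I_n) (x y : 'rV[R]_n), U x -> y != 0 ->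
      partial_x l (mform a) x y =
      \sum_i (\sum_k Gam i l k y * y 0 k
              + 2^-1 * \sum_j \sum_k
                  'D_(delta_mx 0 l) (Gam i j k) y * y 0 j * y 0 k)
             * partial_y i (mform a) x y.
Proof.
move=> oU m2 hF pA.
suff key Gam x : direction_dependent Gam -> U x ->
    (forall i (y : 'rV[R]_n), y != 0 ->
       spray_coef F i x y = direction_spray Gam i y) <->
    (forall l (y : 'rV[R]_n), y != 0 -> partial_x l (mform a) x y =
       \sum_i direction_connection Gam i l y * partial_y i (mform a) x y).
  split=> -[Gam hG E]; exists Gam => //.
    by move=> l x y Ux; apply: (key Gam x hG Ux).1 => i z; exact: E.
  by move=> i x y Ux; apply: (key Gam x hG Ux).2 => l z; exact: E.
move=> hG Ux.
rewrite -(spray_iff_horizontal (homC2_mform a x)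
  (fun k => homC2_partial_x_mform k (mth_root_coef_smooth hF) Ux)
  (fun i l y => is_derive_direction_spray i l hG)
  (fun i y => direction_connection_euler i hG)).
split=> [E y y0|E i y y0].
  by apply/(spray_mth_root _ oU m2 hF pA Ux y0) => i; exact: E.
by move: i; apply/(spray_mth_root _ oU m2 hF pA Ux y0); exact: E.
Qed.
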